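(* Let $X\subset S^{d-1}$ be a kissing configuration and let $C\subset S^{d-1}\setminus X$ be a finite set that is internally compatible, i.e. distinct elements of $C$ have inner product at most $1/2$. For $c\in C$ put $F(c)=\{x\in X:\langle c,x\rangle>1/2\}$, and $F(I)=\bigcup_{c\in I}F(c)$ for $I\subseteq C$. Let $\mathcal{H}$ be the bipartite conflict graph on $C$ and $X$, with $cx$ an edge exactly when $x\in F(c)$, and let $\nu(\mathcal{H})$ be its maximum matching size. Then $$\max_{I\subseteq C}\bigl(|I|-|F(I)|\bigr)=|C|-\nu(\mathcal{H}) .$$ An optimal $I$ is the set of candidate vertices (elements of $C$) reachable from the unmatched candidates by alternating paths of a maximum matching. In particular, no $I\subseteq C$ has $|I|-|F(I)|>0$ if and only if some matching of $\mathcal{H}$ assigns every candidate a distinct old conflict (i.e. saturates $C$). The same formula, multiplied by the common bundle size, applies to internally compatible candidate bundles and old groups of equal cardinality: if $Q_1,\dots,Q_p$ are candidate bundles and $X_1,\dots,X_g$ old groups (as defined in the context), all of the same cardinality $s$, and $\bigcup_iQ_i$ is internally compatible, then $$\max_{I\subseteq\{1,\dots,p\}}\Bigl(\sum_{i\in I}|Q_i|-\sum_{j\in F(I)}|X_j|\Bigr)=s\,\bigl(p-\nu(\mathcal{H}')\bigr),$$ where $\mathcal{H}'$ is the bipartite conflict graph between bundle indices $i$ and group indices $j$, with $ij$ an edge exactly when $j\in F(i)$.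
   Context: A kissing configuration in $S^{d-1}\subset\mathbb{R}^d$ is a set of unit vectors whose distinct members have inner product at most $\tfrac12$. An alternating path from an unmatched candidate traverses unmatched edges from $C$ toward $X$ and matched edges from $X$ toward $C$; an unmatched candidate is regarded as reachable from itself by the path of length zero. Bundle setting: part of $X$ is held fixed, and the remaining (deletable) points of $X$ are partitioned into nonempty groups $X_1,\dots,X_g$. The candidate bundles $Q_1,\dots,Q_p\subset S^{d-1}\setminus X$ are finite, pairwise disjoint, internally compatible (distinct points of a bundle have inner product at most $1/2$), and compatible with the fixed old points (inner products at most $1/2$). $F(i)$ is the set of indices $j$ such that some point of $X_j$ has inner product greater than $1/2$ with some point of $Q_i$, and $F(I)=\bigcup_{i\in I}F(i)$. *)

(* Defs.v *)
From HB Require Import structures.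
From mathcomp Require Import all_boot all_order all_algebra finmap.
From mathcomp Require Import ring lra.
From mathcomp Require Import boolp classical_sets functions cardinality reals.
Set Implicit Arguments.
Unset Strict Implicit.
Unset Printing Implicit Defensive.
Import Order.TTheory GRing.Theory Num.Theory.
Local Open Scope ring_scope.

Definition is_max (T : Type) (f : T -> int) (m : int) : Prop :=
  (exists x, f x = m) /\ (forall x, f x <= m).

Definition maximizes (T : Type) (f : T -> int) (x : T) : Prop :=
  forall y, f y <= f x.

(* A bipartite graph with vertex classes [L] and [T] is its adjacency
   [e : L -> T -> bool]; a set of edges is an [M : {set L * T}]. *)
Section Bipartite.
Variables (L T : finType) (e : L -> T -> bool).

Definition neighbours (I : {set L}) : {set T} :=
  (\bigcup_(c in I) [set x | e c x])%SET.

Definition matching (M : {set L * T}) : bool :=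
  [forall p in M, e p.1 p.2] &&
  [forall p in M, forall q in M, (p.1 == q.1) || (p.2 == q.2) ==> (p == q)].

Definition matching_number : nat := \max_(M : {set L * T} | matching M) #|M|.

Definition maximum_matching (M : {set L * T}) : bool :=
  matching M && (#|M| == matching_number).

Definition matched (M : {set L * T}) (c : L) : bool :=
  [exists x, (c, x) \in M].

Definition saturates (M : {set L * T}) : bool := [forall c, matched M c].

Definition alternating_step (M : {set L * T}) : rel (L + T) := fun a b =>
  match a, b with
  | inl c, inr x => e c x && ((c, x) \notin M)
  | inr x, inl c => (c, x) \in M
  | _, _ => false
  end.

Definition alternating_reachable (M : {set L * T}) : {set L} :=
  [set c | [exists c0, ~~ matched M c0 &&
                       connect (alternating_step M) (inl c0) (inl c)]]%SET.

Definition excess (I : {set L}) : int := #|I|%:Z - #|neighbours I|%:Z.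

End Bipartite.

Local Open Scope classical_set_scope.

Section Sphere.
Variables (R : realType) (d : nat).
Implicit Types u v : 'rV[R]_d.

Definition inner u v : R := \sum_(i < d) u 0 i * v 0 i.

(* The library norm on row vectors is the maximum norm, hence [inner u u]. *)
Definition unit_sphere : set 'rV[R]_d := [set u | inner u u = 1].

Definition compatible (A : set 'rV[R]_d) : Prop :=
  forall u v, A u -> A v -> u != v -> inner u v <= 1 / 2.

Definition kissing (X : set 'rV[R]_d) : Prop :=
  X `<=` unit_sphere /\ compatible X.

(* Kissing configurations are finite, so that [fset_set X] has the same
   elements as [X] (lemma [fset_setK]). *)
Lemma kissing_finite (X : set 'rV[R]_d) : kissing X -> finite_set X.
Proof.
move=> [sX cX]; pose N := d.+1; pose N' : R := N%:R.
have N0 : 0 < N' by rewrite ltr0n.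
pose f u := [ffun i : 'I_d =>
  inord (Num.truncn ((u 0 i + 1) * N')) : 'I_(2 * N).+1].
have coord u i : X u -> 0 <= (u 0 i + 1) * N' < (2 * N).+1%:R.
  move=> /sX /= uu; have : u 0 i * u 0 i <= 1.
    rewrite -uu /inner (bigD1 i)//= lerDl sumr_ge0// => j _.
    by rewrite -expr2 sqr_ge0.
  rewrite -natr1 natrM -/N' => u1.
  have um : -1 <= u 0 i by nra.
  have up : u 0 i <= 1 by nra.
  by apply/andP; split; nra.
have finj : {in X &, injective f}.
  move=> u v; rewrite !inE => Xu Xv /ffunP fuv; apply/eqP/negPn/negP => uv.
  have close i : N' ^+ 2 * (u 0 i - v 0 i) ^+ 2 <= 1.
    have /andP[u0 u1] := coord u i Xu; have /andP[v0 v1] := coord v i Xv.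
    have := fuv i; rewrite !ffunE => /(congr1 val) /=.
    rewrite !inordK ?truncn_lt_nat// => tuv.
    have /andP[] := truncn_itv u0; have /andP[] := truncn_itv v0.
    rewrite -tuv -!natr1 => a b c e.
    by rewrite -exprMn; nra.
  have : inner u v <= 1 / 2 by exact: cX.
  have uu : inner u u = 1 by exact: sX.
  have vv : inner v v = 1 by exact: sX.
  have : \sum_(i < d) (N' ^+ 2 * (u 0 i - v 0 i) ^+ 2) <= \sum_(i < d) 1.
    by apply: ler_sum => i _.
  have -> : \sum_(i < d) (N' ^+ 2 * (u 0 i - v 0 i) ^+ 2) =
      N' ^+ 2 * (inner u u + inner v v - 2 * inner u v).
    rewrite /inner mulrBr mulrDr !mulr_sumr -big_split/= -sumrB.
    by apply: eq_bigr => i _; ring.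
  rewrite sumr_const card_ord uu vv => h1 h2.
  have : d%:R + 1 = N' by rewrite natr1.
  have := ler0n R d; nra.
by rewrite -(eq_finite_set (inj_card_eq finj)); exact: finite_finset.
Qed.

Definition conflict_graph (C X : {fset 'rV[R]_d}) : C -> X -> bool :=
  fun c x => 1 / 2 < inner (val c) (val x).

Section Bundles.
Variables (p g : nat) (Q : 'I_p -> {fset 'rV[R]_d}) (G : 'I_g -> {fset 'rV[R]_d}).

Definition bundle_graph : 'I_p -> 'I_g -> bool := fun i j =>
  [exists u : Q i, [exists x : G j, 1 / 2 < inner (val u) (val x)]].

Definition bundle_excess (I : {set 'I_p}) : int :=
  \sum_(i in I) #|` Q i|%:Z -
  \sum_(j in neighbours bundle_graph I) #|` G j|%:Z.

(* [X0] is the part of [X] that is held fixed. *)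
Definition old_groups (X X0 : set 'rV[R]_d) : Prop :=
  [/\ X0 `<=` X,
      forall j, [set` G j] !=set0,
      trivIset setT (fun j => [set` G j]) &
      \bigcup_j [set` G j] = X `\` X0].

Definition candidate_bundles (X X0 : set 'rV[R]_d) : Prop :=
  [/\ forall i, [set` Q i] `<=` unit_sphere `\` X,
      trivIset setT (fun i => [set` Q i]),
      forall i, compatible [set` Q i] &
      forall i u x, u \in Q i -> X0 x -> inner u x <= 1 / 2].

End Bundles.

End Sphere.

Arguments unit_sphere : clear implicits.
Arguments conflict_graph {R d} C X _ _.

(* Main.v *)
(* Weak duality: splitting a matching M by whether the candidate endpoint lies
   in I bounds |M| by |F(I)| plus the number of candidates outside I.  For a
   maximum matching, every conflict of a reachable candidate is matched to a
   reachable candidate, since otherwise an augmenting path would exist; all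
   candidates outside the reachable set are matched, so the reachable set attains
   the bound.  For bundles and groups of common size s the objective is s times
   the excess in the graph on indices. *)
Require Import Defs.
From HB Require Import structures.
From mathcomp Require Import all_boot all_order all_algebra finmap.
From mathcomp Require Import boolp classical_sets functions cardinality reals.
From mathcomp Require Import zify.
Set Implicit Arguments.
Unset Strict Implicit.
Unset Printing Implicit Defensive.
Import Order.TTheory GRing.Theory Num.Theory.
Local Open Scope ring_scope.

Section KonigDeficiency.
Variables (L T : finType) (e : L -> T -> bool).
Implicit Types (M : {set L * T}) (I : {set L}).

(** * Matchings in a finite bipartite graph *)

Lemma neighboursP I x :
  reflect (exists2 c, c \in I & e c x) (x \in neighbours e I).
Proof.
apply: (iffP bigcupP) => -[c cI]; last by exists c; rewrite ?inE.
by rewrite inE; exists c.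
Qed.

Lemma matchingP M :
  reflect [/\ forall c x, (c, x) \in M -> e c x,
              forall c x y, (c, x) \in M -> (c, y) \in M -> x = y &
              forall c b x, (c, x) \in M -> (b, x) \in M -> c = b]
          (matching e M).
Proof.
apply: (iffP andP) => [[/forall_inP eM /forall_inP injM]|[eM inj1 inj2]].
  split=> [c x /eM //|c x y Mx My|c b x Mc Mb].
    have /forall_inP/(_ _ My) := injM _ Mx.
    by rewrite eqxx => /eqP[].
  have /forall_inP/(_ _ Mb) := injM _ Mc.
  by rewrite eqxx orbT => /eqP[].
split; first by apply/forall_inP => -[c x] /eM.
apply/forall_inP => -[c x] Mc; apply/forall_inP => -[b y] Mb /=.
apply/implyP => /orP[] /eqP E; subst.
  by rewrite (inj1 _ _ _ Mc Mb).
by rewrite (inj2 _ _ _ Mc Mb).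
Qed.

Lemma matchedP M c : reflect (exists x, (c, x) \in M) (matched M c).
Proof. exact: existsP. Qed.

Lemma matching0 : matching e finset.set0.
Proof. by apply/matchingP; split=> ? ?; rewrite ?inE// => ?; rewrite inE. Qed.

Lemma leq_matching_number M : matching e M -> (#|M| <= matching_number e)%N.
Proof. exact: leq_bigmax_cond. Qed.

Lemma maximum_matching_exists : exists M, maximum_matching e M.
Proof.
have [|M mM eqM] :=
    @eq_bigmax_cond _ (matching e) (fun N : {set L * T} => #|N|).
  (* A maximum is attained only over a nonempty family; the empty matching provides a member. *)
  by apply/card_gt0P; exists finset.set0; exact: matching0.
by exists M; apply/andP; split=> //; rewrite /matching_number eqM.
Qed.

Lemma card_matching_split M I :
  #|M| = (#|[set p in M | p.1 \in I]%SET| + #|[set p in M | p.1 \notin I]%SET|)%N.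
Proof.
rewrite -(cardsID [set p | p.1 \in I]%SET M).
by congr (_ + _)%N; apply: eq_card => q; rewrite !inE// andbC.
Qed.

(** Edges starting in [I] inject into the neighbours of [I] by their right endpoints; the other
    edges inject into the complement of [I] by their left endpoints. *)
Lemma matching_leq M I : matching e M ->
  (#|M| <= #|neighbours e I| + #|~: I|)%N.
Proof.
move=> /matchingP[eM inj1 inj2]; rewrite (card_matching_split M I).
apply: leq_add.
  rewrite -(card_in_imset (f := snd)).
    apply/subset_leq_card/fintype.subsetP => _ /imsetP[[c x] + ->].
    rewrite inE /= => /andP[/eM ecx cI].
    by apply/neighboursP; exists c.
  move=> [c x] [b y]; rewrite !inE /= => /andP[Mc _] /andP[Mb _] E; subst.
  by rewrite (inj2 _ _ _ Mc Mb).
rewrite -(card_in_imset (f := fst)).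
  apply/subset_leq_card/fintype.subsetP => _ /imsetP[[c x] + ->].
  by rewrite !inE /= => /andP[].
move=> [c x] [b y]; rewrite !inE /= => /andP[Mc _] /andP[Mb _] E; subst.
by rewrite (inj1 _ _ _ Mc Mb).
Qed.

(** * Augmenting paths *)

Lemma matching_add M c x : matching e M -> ~~ matched M c ->
  (forall b, (b, x) \notin M) -> e c x -> matching e ((c, x) |: M).
Proof.
move=> /matchingP[eM inj1 inj2] /matchedP uc ux ecx.
have uc' y : (c, y) \notin M by apply/negP => My; apply: uc; exists y.
apply/matchingP; split.
- by move=> b y /setU1P[[-> ->]//|/eM].
- move=> b y z /setU1P[[-> ->]|My] /setU1P[[]|Mz].
  + by move->.
  + by rewrite (negPf (uc' _)) in Mz.
  + by move=> E; rewrite E (negPf (uc' _)) in My.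
  + exact: inj1 My Mz.
- move=> a b y /setU1P[[-> ->]|My] /setU1P[[]|Mz].
  + by move->.
  + by rewrite (negPf (ux _)) in Mz.
  + by move=> _ E; rewrite E (negPf (ux _)) in My.
  + exact: inj2 My Mz.
Qed.

Lemma matching_subset M M' :
  M' \subset M -> matching e M -> matching e M'.
Proof.
move=> /fintype.subsetP sM /matchingP[eM inj1 inj2]; apply/matchingP; split.
- by move=> c x /sM/eM.
- by move=> c x y /sM Mx /sM My; exact: inj1 Mx My.
- by move=> c b x /sM Mx /sM My; exact: inj2 Mx My.
Qed.

(* Shift the matching by one step: rematching [x1] from [c1] to [c0] keeps the
   size, frees [c1], and the tail of the simple path is still alternating. *)
Lemma augment M c0 x (p : seq (L + T)) :
  matching e M -> ~~ matched M c0 -> (forall b, (b, x) \notin M) ->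
  path (alternating_step e M) (inl c0) p -> uniq (inl c0 :: p) ->
  last (inl c0) p = inr x ->
  exists2 M', matching e M' & #|M'| = #|M|.+1.
Proof.
(* Each step strips two vertices off the path and changes both the matching and the start, so the
   induction is on a bound for the length, with [M] and [c0] general; the free end [x] stays
   fixed. *)
elim: {p}(size p) {-2}p (leqnn (size p)) M c0 => [|n IH] [|[c|x1] [|[c1|y] p]] //=;
  move=> sp M c0 mM uc0 ux; rewrite ?andbF//.
  rewrite andbT => /andP[ecx nM] _ [E]; subst x1.
  exists ((c0, x) |: M); first exact: matching_add.
  by rewrite cardsU1 nM.
move=> /and3P[/andP[ec0 nM] Mc1 pp].
rewrite !inE !negb_or => /and3P[/and3P[_ c01 c0p] /andP[_ x1p] /andP[c1p up]] lp.
have mD : matching e (M :\ (c1, x1)) by apply: matching_subset mM; exact: subsetDl.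
have uc0' y : (c0, y) \notin M by apply: contra uc0 => My; apply/matchedP; exists y.
have [eM inj1 inj2] := matchingP _ mM.
pose M1 := (c0, x1) |: (M :\ (c1, x1)).
(* The end [x] lies on the tail [p], which avoids [x1] since the path is simple; hence [x] stays
   free in [M1]. *)
have xx1 : x != x1.
  apply: contraNneq x1p => <-; rewrite -lp.
  by case: (p) lp => //= a q _; exact: mem_last.
have c10 : c1 != c0 by apply: contraNneq (uc0' x1) => <-.
have mM1 : matching e M1.
  apply: matching_add => //.
    by apply/matchedP => -[y]; rewrite !inE (negPf (uc0' _)) andbF.
  move=> b; rewrite !inE; apply/negP => /andP[nb Mb].
  by rewrite (inj2 _ _ _ Mb Mc1) eqxx in nb.
have cM1 : #|M1| = #|M|.
  by rewrite cardsU1 !inE (negPf (uc0' _)) andbF /= (cardsD1 (c1, x1) M) Mc1.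
have ltp : (size p <= n)%N by exact: ltnW.
rewrite -cM1; apply: (IH p ltp M1 c1) => //.
- apply/matchedP => -[y]; rewrite !inE !xpair_eqE (negPf c10) eqxx /=.
  by move=> /andP[ny My]; rewrite (inj1 _ _ _ My Mc1) eqxx in ny.
- move=> b; rewrite !inE !xpair_eqE (negPf xx1) !andbF /=.
  exact: ux.
(* [M] and [M1] differ only in edges at [x1], which the tail avoids, so its steps alternate for [M1]
   as well. *)
- pose P : pred (L + T) := [pred a | (a != inl c0) && (a != inr x1)].
  rewrite -(@eq_in_path _ P (alternating_step e M)) //.
    move=> [a|a] [b|b]; rewrite /in_mem /= ?andbT => na nb //.
      by rewrite !inE !xpair_eqE (negPf nb : (b == x1) = false) !andbF.
    by rewrite !inE !xpair_eqE (negPf na : (a == x1) = false) !andbF.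
  apply/andP; split; first by rewrite /P inE andbT.
  apply/allP => a ap /=.
  by apply/andP; split; apply: contraTneq ap => ->.
- by rewrite /= c1p.
Qed.

(** If the edge from a reachable [c] to [x] is unmatched, then [x] is reachable too. So is its
    partner, when it has one; with no partner, the path to [x] would augment [M]. *)
Lemma reachable_neighbour M x : maximum_matching e M ->
  x \in neighbours e (alternating_reachable e M) ->
  exists2 c, c \in alternating_reachable e M & (c, x) \in M.
Proof.
move=> /andP[mM /eqP cM] /neighboursP[c cA ecx].
have [Mc|nM] := boolP ((c, x) \in M); first by exists c.
move: cA; rewrite inE => /existsP[c0 /andP[uc0 c0c]].
have c0x : connect (alternating_step e M) (inl c0) (inr x).
  by apply: connect_trans c0c (connect1 _); rewrite /= ecx.
have [/existsP[b Mb]|/existsPn ux] := boolP [exists b, (b, x) \in M].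
  exists b => //; rewrite inE; apply/existsP; exists c0; rewrite uc0 /=.
  by apply: connect_trans c0x (connect1 _).
have /connectP[p0 pp0 lp0] := c0x.
(* Reachability gives only a walk, while augmenting needs a simple path. *)
case/shortenP: pp0 lp0 => p pp up _ /esym lp.
have [M' mM' cM'] := augment mM uc0 ux pp up lp.
by have := leq_matching_number mM'; rewrite cM' cM ltnn.
Qed.

(** This is weak duality reversed. Matched edges at reachable candidates hit every neighbour, and an
    unreachable candidate is matched because an unmatched one reaches itself by the path of length
    zero. *)
Lemma reachable_leq M : maximum_matching e M ->
  (#|neighbours e (alternating_reachable e M)| +
   #|~: alternating_reachable e M| <= #|M|)%N.
Proof.
move=> xM; set A := alternating_reachable e M.
rewrite (card_matching_split M A); apply: leq_add.
  apply: leq_trans (leq_imset_card snd _).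
  apply/subset_leq_card/fintype.subsetP => x /(reachable_neighbour xM)[c cA Mc].
  by apply/imsetP; exists (c, x); rewrite // inE Mc.
apply: leq_trans (leq_imset_card fst _).
apply/subset_leq_card/fintype.subsetP => c; rewrite inE => cA.
have [/matchedP[x Mc]|uc] := boolP (matched M c).
  by apply/imsetP; exists (c, x); rewrite // inE Mc.
by case/negP: cA; rewrite inE; apply/existsP; exists c; rewrite uc connect0.
Qed.

(** * The deficiency formula and saturating matchings *)

Lemma excess_leq I : excess e I <= #|L|%:Z - (matching_number e)%:Z.
Proof.
have [M /andP[mM /eqP cM]] := maximum_matching_exists.
have := matching_leq I mM; rewrite /excess -cM -(cardsC I); lia.
Qed.

Lemma excess_reachable M : maximum_matching e M ->
  excess e (alternating_reachable e M) = #|L|%:Z - (matching_number e)%:Z.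
Proof.
move=> xM; apply/eqP; rewrite eq_le excess_leq /=.
have := reachable_leq xM; have /andP[_ /eqP cM] := xM.
by rewrite /excess -cM -(cardsC (alternating_reachable e M)); lia.
Qed.

Lemma excess_is_max : is_max (excess e) (#|L|%:Z - (matching_number e)%:Z).
Proof.
split; last exact: excess_leq.
have [M xM] := maximum_matching_exists.
by exists (alternating_reachable e M); exact: excess_reachable.
Qed.

Lemma card_image_matching M : matching e M ->
  #|[set p.1 | p in M]%SET| = #|M|.
Proof.
move=> /matchingP[_ inj1 _]; apply: card_in_imset => -[c x] [b y] /= Mc Mb E.
by subst; rewrite (inj1 _ _ _ Mc Mb).
Qed.

(** A matching covers exactly as many candidates as it has edges, so saturation becomes a comparison
    of sizes. *)
Lemma matching_saturates M : matching e M -> saturates M = (#|L| <= #|M|)%N.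
Proof.
move=> mM; rewrite -(card_image_matching mM); set D := imset _ _.
have memD c : (c \in D) = matched M c.
  apply/imsetP/matchedP => [[[b x] Mb ->]|[x Mc]]; first by exists x.
  by exists (c, x).
apply/forallP/idP => [sM|leLD c].
  by apply/subset_leq_card/fintype.subsetP => c _; rewrite memD.
have /eqP E : D == [set: L]%SET by rewrite eqEcard finset.subsetT cardsT.
by rewrite -memD E finset.in_setT.
Qed.

Lemma no_positive_excess :
  ~ (exists I, 0 < excess e I) <-> exists M, matching e M /\ saturates M.
Proof.
split=> [nI|[M [mM]]].
  have [M xM] := maximum_matching_exists; have /andP[mM /eqP cM] := xM.
  exists M; split=> //; rewrite matching_saturates// leqNgt.
  (* If a maximum matching is too small to saturate, its reachable set has positive excess. *)
  apply/negP => ltM; apply: nI; exists (alternating_reachable e M).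
  by rewrite excess_reachable// -cM; lia.
rewrite matching_saturates// => leM [I].
by have := excess_leq I; have := leq_matching_number mM; lia.
Qed.

End KonigDeficiency.

(** * Bundles and groups of common size *)

Lemma bundle_excess_const (R : realType) (d p g s : nat)
    (Q : 'I_p -> {fset 'rV[R]_d}) (G : 'I_g -> {fset 'rV[R]_d}) (I : {set 'I_p}) :
  (forall i, #|` Q i| = s) -> (forall j, #|` G j| = s) ->
  bundle_excess Q G I = s%:Z * excess (bundle_graph Q G) I.
Proof.
move=> cQ cG; have sE n : s%:Z *+ n = s%:Z * n%:Z by rewrite -mulr_natr natz.
rewrite /bundle_excess /excess.
rewrite (eq_bigr (fun=> s%:Z)) => [|i _]; last by rewrite cQ.
rewrite (eq_bigr (fun=> s%:Z) (F1 := fun j => #|` G j|%:Z)) => [|j _];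
  last by rewrite cG.
by rewrite !sumr_const mulrBr !sE.
Qed.

Local Open Scope classical_set_scope.

Theorem proposition5p2 (R : realType) (d : nat) (X : set 'rV[R]_d) :
  kissing X ->
  (forall C : {fset 'rV[R]_d},
     [set` C] `<=` unit_sphere R d `\` X ->
     compatible [set` C] ->
     let H := conflict_graph C (fset_set X) in
     [/\ is_max (excess H) (#|` C|%:Z - (matching_number H)%:Z),
         forall M, maximum_matching H M ->
           maximizes (excess H) (alternating_reachable H M) &
         ~ (exists I, 0 < excess H I) <->
         (exists M, matching H M /\ saturates M)]) /\
  (forall (p g s : nat) (X0 : set 'rV[R]_d)
      (Q : 'I_p -> {fset 'rV[R]_d}) (G : 'I_g -> {fset 'rV[R]_d}),
     old_groups G X X0 ->
     candidate_bundles Q X X0 ->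
     (forall i, #|` Q i| = s) ->
     (forall j, #|` G j| = s) ->
     compatible (\bigcup_i [set` Q i]) ->
     is_max (bundle_excess Q G)
       (s%:Z * (p%:Z - (matching_number (bundle_graph Q G))%:Z))).
Proof.
move=> _; split=> [C _ _ H|p g s X0 Q G _ _ cQ cG _].
  rewrite cardfE; split; first exact: excess_is_max.
  - by move=> M xM I; rewrite excess_reachable//; exact: excess_leq.
  - exact: no_positive_excess.
have [[I eI] leI] := excess_is_max (bundle_graph Q G); rewrite card_ord in eI leI.
split; first by exists I; rewrite (bundle_excess_const _ cQ cG) eI.
(* Scaling by [s] keeps the bound since [s] is nonnegative; [s = 0] is allowed. *)
by move=> J; rewrite (bundle_excess_const _ cQ cG) ler_wpM2l.
Qed.
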